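(* Assume that for all $a\in A$, $c\in C$, $g\in G$ the map $\varphi\mapsto\mathbf{H}(a,c,g,\varphi)$ is continuous on $K$, and for all $T\in\mathcal{H}$, $a\in A$, $c\in C$, $g\in G$ the map $\psi\mapsto\mathbf{M}(T,a,c,g,\psi)$ is continuous on $W$. If $0<q_1\le q_2\le s_2\le s_1\le\infty$, then every $\mathbf{H}$--$\mathbf{M}$-$((s_1;q_1),q_1)$-mixing map $T\in\mathcal{H}$ is $\mathbf{H}$--$\mathbf{M}$-$((s_2;q_2),q_2)$-mixing; that is, $$\mathfrak{M}^{\mathbf{H}-\mathbf{M}}_{((s_1;q_1),q_1)}(A,B)\subseteq\mathfrak{M}^{\mathbf{H}-\mathbf{M}}_{((s_2;q_2),q_2)}(A,B).$$
   Context: $A,B,C$ are non-void sets, $\mathcal{H}$ is a non-void family of mappings from $A$ into $B$, $G$ is a Banach space, $K,W$ are (non-void) compact Hausdorff spaces, and $\mathbf{H}:A\times C\times G\times K\to\mathbb{R}$, $\mathbf{M}:\mathcal{H}\times A\times C\times G\times W\to\mathbb{R}$ are maps. Expressions $[\sum|\cdot|^p]^{1/p}$ with $p=\infty$ are read as suprema. For $0<q\le s\le\infty$ let $r\in(0,\infty]$ with $\frac1r+\frac1s=\frac1q$. For nonzero reals $\sigma_j$ and $a_j\in A$, $c_j\in C$, $g_j\in G$ set $$\mathfrak{m}^{\mathbf{M}}_{(s;q)}\left((\sigma_j,T,a_j,c_j,g_j,\psi)\right)_{j=1}^m=\inf\left[\sum_{j=1}^m|\tau_j|^r\right]^{1/r}\sup_{\psi\in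 W}\left[\sum_{j=1}^m\left|\frac{\sigma_j}{\tau_j}\right|^s|\mathbf{M}(T,a_j,c_j,g_j,\psi)|^s\right]^{1/s},$$ the infimum being over all families of nonzero numbers $\tau_1,\dots,\tau_m$. $T\in\mathcal{H}$ is $\mathbf{H}$--$\mathbf{M}$-$((s;q),q)$-mixing if there is $\delta\ge0$ with $$\mathfrak{m}^{\mathbf{M}}_{(s;q)}\left((\sigma_j,T,a_j,c_j,g_j,\psi)\right)_{j=1}^m\le\delta\sup_{\varphi\in K}\left[\sum_{j=1}^m|\sigma_j|^q|\mathbf{H}(a_j,c_j,g_j,\varphi)|^q\right]^{1/q}$$ for all $m\in\mathbb{N}$, nonzero $\sigma_j\in\mathbb{R}$, $a_j\in A$, $c_j\in C$, $g_j\in G$. The class of all such maps is $\mathfrak{M}^{\mathbf{H}-\mathbf{M}}_{((s;q),q)}(A,B)$. *)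

(* Defs.v *)
From HB Require Import structures.
From mathcomp Require Import all_boot all_order all_algebra.
From mathcomp Require Import all_classical all_reals all_analysis.

Set Implicit Arguments.
Unset Strict Implicit.
Unset Printing Implicit Defensive.

Import Order.TTheory GRing.Theory Num.Theory.
Import numFieldNormedType.Exports.

Local Open Scope classical_set_scope.
Local Open Scope ring_scope.

(* [sum_j |x_j|^p]^(1/p), read as sup_j |x_j| when p = +oo; only exponents
   p with 0 < p are meaningful (-oo gets the same junk value as +oo). *)
Definition psum_norm (R : realType) (m : nat) (p : \bar R)
    (x : 'I_m -> R) : R :=
  if p is p'%:E then (\sum_(j < m) `|x j| `^ p') `^ p'^-1
  else \big[Num.max/0]_(j < m) `|x j|.

(* The exponent r with 1/r + 1/s = 1/q, where in \bar R 1/+oo = 0 and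
   1/0 = +oo; [conj_exp_spec] characterizes it. *)
Definition conj_exp (R : realType) (s q : \bar R) : \bar R :=
  (q^-1 - s^-1)^-1%E.

Lemma conj_exp_spec (R : realType) (s q r : \bar R) :
  (0 < q)%E -> (q <= s)%E ->
  (0 < r)%E /\ (r^-1 + s^-1 = q^-1)%E <-> r = conj_exp s q.
Proof.
move=> q0 qs; rewrite /conj_exp.
have s0 : (0 < s)%E by exact: lt_le_trans qs.
have fV (x : \bar R) : (0 < x)%E -> (x^-1)%E \is a fin_num.
  case: x => [x| |].
  - by rewrite lte_fin => x0; rewrite inver gt_eqF.
  - by rewrite invey.
  - by rewrite ltNge leNye.
have fs := fV _ s0.
have fq := fV _ q0.
split=> [[r0 <-]|->]; first by rewrite addeK// inveK.
rewrite inveK subeK//; split=> //.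
have d0 : (0 <= q^-1 - s^-1)%E.
  by rewrite sube_ge0 ?fs// lee_pV2// inE ltW.
rewrite lt_neqAle inve_ge0 d0 andbT eq_sym inve_eq0.
by move: fq fs; case: (q^-1)%E => // a; case: (s^-1)%E.
Qed.

Section Mixing.
Context (R : realType) (A B C : Type) (G : completeNormedModType R).
Context (K W : topologicalType) (F : set (A -> B)).
Context (H : A -> C -> G -> K -> R) (M : F -> A -> C -> G -> W -> R).

(* The value lies in [0, +oo]; it is finite whenever the supremum over W is
   finite for some tau. *)
Definition mixing_functional (s q : \bar R) (T : F) (m : nat)
    (sigma : 'I_m -> R) (a : 'I_m -> A) (c : 'I_m -> C) (g : 'I_m -> G) :
    \bar R :=
  ereal_inf [set ((psum_norm (conj_exp s q) tau)%:E *
      ereal_sup (range (fun psi : W =>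
        (psum_norm s (fun j =>
           `|sigma j / tau j| * `|M T (a j) (c j) (g j) psi|))%:E)))%E
    | tau in [set tau : 'I_m -> R | forall j, tau j != 0]].

Definition weak_norm (q : \bar R) (m : nat)
    (sigma : 'I_m -> R) (a : 'I_m -> A) (c : 'I_m -> C) (g : 'I_m -> G) :
    \bar R :=
  ereal_sup (range (fun phi : K =>
    (psum_norm q (fun j => `|sigma j| * `|H (a j) (c j) (g j) phi|))%:E)).

Definition is_mixing (s q : \bar R) (T : F) : Prop :=
  exists2 delta : R, 0 <= delta &
    forall (m : nat) (sigma : 'I_m.+1 -> R) (a : 'I_m.+1 -> A)
      (c : 'I_m.+1 -> C) (g : 'I_m.+1 -> G),
      (forall j, sigma j != 0) ->
      (mixing_functional s q T sigma a c g
        <= delta%:E * weak_norm q sigma a c g)%E.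

Definition mixing_class (s q : \bar R) : set F :=
  [set T | is_mixing s q T].

End Mixing.

(* Main.v *)
Require Import Defs.
From HB Require Import structures.
From mathcomp Require Import all_boot all_order all_algebra.
From mathcomp Require Import all_classical all_reals all_analysis.
From mathcomp Require Import ring lra.

Set Implicit Arguments.
Unset Strict Implicit.
Unset Printing Implicit Defensive.

Import Order.TTheory GRing.Theory Num.Theory.
Import numFieldNormedType.Exports.

Local Open Scope classical_set_scope.
Local Open Scope ring_scope.

(* The infimum defining the mixing functional is dual to a supremum: with
   u_j(psi) = |M(T, a_j, c_j, g_j, psi)|, it is the supremum of
   [sum |sigma_j N_j|^q]^(1/q) over the N >= 0 whose s-th powers lie in the
   polar hull of the s-th powers of u ("N is s-dominated by u"). Hoelder gives
   one inequality; for the other, the first-order condition at a maximum of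
   the concave function z |-> sum |sigma_j|^q (z_j + eps)^(q/s) over that
   compact convex hull exhibits an almost optimal tau.
   Domination passes to larger exponents. Hence an N that is s2-dominated by u
   is s1-dominated by u; mixing for (s1; q1) then says that N is q1-dominated
   by delta |H|, so N is q2-dominated by delta |H|, and duality for (s2; q2)
   turns this back into the mixing inequality. *)

(** * Convexity inequalities for real powers and finite sums *)

Lemma weighted_am_gm (R : realType) (a b t : R) :
  0 <= a -> 0 <= b -> 0 <= t <= 1 ->
  a `^ (1 - t) * b `^ t <= (1 - t) * a + t * b.
Proof.
move=> a0 b0 /andP[]; rewrite le_eqVlt => /predU1P[<- _|t0].
  by rewrite subr0 powRr1// powRr0 mulr1 mul1r mul0r addr0.
rewrite le_eqVlt => /predU1P[->|t1].
  by rewrite subrr powRr0 powRr1// mul0r add0r.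
have u0 : 0 < 1 - t by rewrite subr_gt0.
have := @conjugate_powR R (a `^ (1 - t)) (b `^ t) (1 - t)^-1 t^-1
  (powR_ge0 _ _) (powR_ge0 _ _).
rewrite !invr_gt0 !invrK -!powRrM !divff ?gt_eqF// !powRr1// => /(_ u0 t0).
by rewrite subrK => /(_ erefl); rewrite (mulrC a) (mulrC b).
Qed.

(** Concavity of the power [t]: multiplying weighted AM-GM by [a ^ (t - 1)] cancels the factor
    [a ^ (1 - t)] and leaves the tangent line at [a]. *)
Lemma powR_le_tangent (R : realType) (a b t : R) :
  0 < a -> 0 <= b -> 0 <= t <= 1 ->
  b `^ t <= a `^ t + t * a `^ (t - 1) * (b - a).
Proof.
move=> a0 b0 t01; have := weighted_am_gm (ltW a0) b0 t01.
have an0 : a != 0 by rewrite gt_eqF.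
rewrite -(ler_pM2l (powR_gt0 (t - 1) a0)) mulrA -powRD ?an0 ?implybT//.
rewrite (_ : t - 1 + (1 - t) = 0); last by ring.
rewrite powRr0 mul1r => /le_trans; apply.
have -> : a `^ t = a `^ (t - 1) * a.
  by rewrite -{3}(powRr1 (ltW a0)) -powRD ?an0 ?implybT// subrK.
by rewrite le_eqVlt; apply/orP; left; apply/eqP; ring.
Qed.

(** Each share [c / (a + b)] lies in [0, 1], hence is at most its own [t]-th power; the two shares
    add up to 1. *)
Lemma powRD_le (R : realType) (a b t : R) :
  0 <= a -> 0 <= b -> 0 <= t <= 1 -> (a + b) `^ t <= a `^ t + b `^ t.
Proof.
move=> a0 b0 /andP[t0 t1].
have [/eqP|ab0] := eqVneq (a + b) 0.
  by rewrite paddr_eq0// => /andP[/eqP-> /eqP->]; rewrite addr0 lerDl powR_ge0.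
have {}ab0 : 0 < a + b by rewrite lt_neqAle eq_sym ab0 addr_ge0.
have frac c : 0 <= c <= a + b -> c / (a + b) * (a + b) `^ t <= c `^ t.
  move=> /andP[]; rewrite le_eqVlt => /predU1P[<- _|c0 cab].
    by rewrite !mul0r powR_ge0.
  rewrite -[X in _ <= X `^ _](divfK (lt0r_neq0 ab0)).
  rewrite powRM ?divr_ge0 ?(ltW c0) ?(ltW ab0)//.
  rewrite ler_wpM2r ?powR_ge0// ger1_powR//.
  by rewrite divr_gt0//= ler_pdivrMr// mul1r.
apply: le_trans (lerD (frac a _) (frac b _)); rewrite ?a0 ?b0 ?lerDl ?lerDr//.
by rewrite -mulrDl -mulrDl divff ?mul1r// gt_eqF.
Qed.

(** Once both sums are normalized to 1, weighted AM-GM applied termwise bounds the left side by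
    [(1 - t) + t = 1]. A vanishing sum makes every term vanish. *)
Lemma hoelder_sum (R : realType) (I : finType) (a b : I -> R) (t : R) :
  (forall i, 0 <= a i) -> (forall i, 0 <= b i) -> 0 < t < 1 ->
  \sum_i a i `^ (1 - t) * b i `^ t <=
  (\sum_i a i) `^ (1 - t) * (\sum_i b i) `^ t.
Proof.
move=> a0 b0 /andP[t0 t1].
have u0 : 0 < 1 - t by rewrite subr_gt0.
have [SA0|SA0] := eqVneq (\sum_i a i) 0.
  rewrite big1 ?mulr_ge0 ?powR_ge0// => i _.
  by rewrite (psumr_eq0P _ SA0)// powR0 ?mul0r// gt_eqF.
have [SB0|SB0] := eqVneq (\sum_i b i) 0.
  rewrite big1 ?mulr_ge0 ?powR_ge0// => i _.
  by rewrite (psumr_eq0P _ SB0)// [X in _ * X]powR0 ?mulr0// gt_eqF.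
set SA := \sum_i a i in SA0 *; set SB := \sum_i b i in SB0 *.
have A0 : 0 < SA by rewrite lt_neqAle eq_sym SA0 sumr_ge0.
have B0 : 0 < SB by rewrite lt_neqAle eq_sym SB0 sumr_ge0.
have -> : \sum_i a i `^ (1 - t) * b i `^ t = SA `^ (1 - t) * SB `^ t *
    \sum_i (a i / SA) `^ (1 - t) * (b i / SB) `^ t.
  rewrite mulr_sumr; apply: eq_bigr => i _.
  rewrite mulrACA -!powRM ?divr_ge0 ?(ltW A0) ?(ltW B0)//.
  by rewrite ![_ * (_ / _)]mulrC !divfK ?gt_eqF.
rewrite ler_piMr ?mulr_ge0 ?powR_ge0//.
apply: (@le_trans _ _ (\sum_i ((1 - t) * (a i / SA) + t * (b i / SB)))).
  apply: ler_sum => i _; apply: weighted_am_gm.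
  - by rewrite divr_ge0// ltW.
  - by rewrite divr_ge0// ltW.
  - by rewrite !ltW.
by rewrite big_split/= -!mulr_sumr -!mulr_suml !divff ?gt_eqF// !mulr1 subrK.
Qed.

(** * The norms [psum_norm], conjugate exponents and the Hoelder inequality *)

Section PsumNorm.
Context (R : realType) (m : nat).
Implicit Types (x y : 'I_m -> R) (p : \bar R).

Lemma psum_norm_ge0 p x : 0 <= psum_norm p x.
Proof.
case: p => [p| |] /=; rewrite ?powR_ge0//.
all: by elim/big_ind: _ => // a b a0 b0; rewrite le_max a0.
Qed.

Lemma psum_norm_fin_le (p Y : R) x : 0 < p -> 0 <= Y ->
  (psum_norm p%:E x <= Y) = (\sum_j `|x j| `^ p <= Y `^ p).
Proof.
move=> p0 Y0 /=.
have S0 : 0 <= \sum_j `|x j| `^ p by apply: sumr_ge0 => j _; exact: powR_ge0.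
apply/idP/idP => h.
  rewrite -[leLHS](powRr1 S0) -(mulVf (lt0r_neq0 p0)) powRrM.
  by rewrite ge0_ler_powR ?nnegrE ?powR_ge0// ltW.
rewrite -[leRHS](powRr1 Y0) -(mulfV (lt0r_neq0 p0)) powRrM.
by rewrite ge0_ler_powR ?nnegrE ?powR_ge0// invr_ge0 ltW.
Qed.

Lemma psum_norm_pinfty_le (Y : R) x : 0 <= Y ->
  psum_norm +oo x <= Y <-> forall j, `|x j| <= Y.
Proof.
move=> Y0 /=; split=> [h j|h].
  by apply: le_trans h; exact: (le_bigmax_cond _ (fun j => `|x j|)).
by apply/bigmax_leP; split.
Qed.

End PsumNorm.

Lemma conj_exp_pinfty (R : realType) (q : \bar R) : (0 < q)%E ->
  conj_exp +oo q = q.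
Proof. by move=> q0; rewrite /conj_exp invey oppe0 adde0 inveK. Qed.

Lemma conj_exp_same (R : realType) (q : R) : 0 < q ->
  conj_exp q%:E q%:E = +oo%E.
Proof.
by move=> q0; rewrite /conj_exp inver gt_eqF// -EFinB subrr inve0.
Qed.

(** The form [q / (1 - t)] with [t = q / s] matches the exponents [1 - t] and [t] of Hoelder's
    inequality. *)
Lemma conj_exp_fin (R : realType) (s q : R) : 0 < q -> q < s ->
  conj_exp s%:E q%:E = (q / (1 - q / s))%:E.
Proof.
move=> q0 qs; have s0 := lt_trans q0 qs.
rewrite /conj_exp !inver !gt_eqF// -EFinB inver gt_eqF; last first.
  by rewrite subr_gt0 ltf_pV2.
congr (_%:E); field.
by rewrite subr_eq0 !gt_eqF.
Qed.

(** Hoelder for the factorization of [y j] into [tau j] and [y j / tau j]. The genuine case is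
    [q < s] finite; for [q = s] or [s = +oo] one factor is bounded by its maximum. *)
Lemma psum_norm_hoelder (R : realType) (m : nat) (s q : \bar R)
    (tau y : 'I_m -> R) :
  (0 < q)%E -> (q <= s)%E -> (forall j, tau j != 0) ->
  psum_norm q y <=
  psum_norm (conj_exp s q) tau * psum_norm s (fun j => y j / tau j).
Proof.
move=> q0 qs t0.
have s0 : (0 < s)%E by exact: lt_le_trans qs.
have yE j : `|y j| = `|tau j| * `|y j / tau j|.
  by rewrite -normrM mulrC divfK.
have P0 := mulr_ge0 (psum_norm_ge0 (conj_exp s q) tau)
  (psum_norm_ge0 s (fun j => y j / tau j)).
case: s s0 qs P0 => [s| |]// s0 qs P0.
  case: q q0 qs P0 => [q| |]// q0 qs P0; rewrite !lte_fin in q0 s0.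
  rewrite lee_fin le_eqVlt in qs.
  case/predU1P: qs => [qs|qs].
    rewrite -{}qs in P0 *; rewrite conj_exp_same// in P0 *.
    rewrite psum_norm_fin_le// powRM ?psum_norm_ge0//.
    apply: (@le_trans _ _
      (\sum_j psum_norm +oo tau `^ q * `|y j / tau j| `^ q)).
      apply: ler_sum => j _; rewrite yE powRM// ler_wpM2r ?powR_ge0//.
      rewrite ge0_ler_powR ?nnegrE ?psum_norm_ge0 ?(ltW q0)//.
      by apply: (psum_norm_pinfty_le _ _).1; rewrite ?psum_norm_ge0.
    rewrite -mulr_sumr ler_wpM2l ?powR_ge0//.
    by rewrite -psum_norm_fin_le ?psum_norm_ge0.
  rewrite conj_exp_fin// in P0 *.
  have th1 : q / s < 1 by rewrite ltr_pdivrMr// mul1r.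
  have th0 : 0 < q / s by rewrite divr_gt0.
  rewrite psum_norm_fin_le// powRM ?psum_norm_ge0//= -!powRrM.
  have -> : (q / (1 - q / s))^-1 * q = 1 - q / s.
    by field; rewrite !gt_eqF// subr_gt0.
  rewrite (mulrC s^-1).
  (* With [t = q / s], the powers [1 - t] and [t] of these two families are the [q]-th powers of
     [|tau j|] and [|y j / tau j|]. *)
  have := @hoelder_sum R 'I_m (fun j => `|tau j| `^ (q / (1 - q / s)))
    (fun j => `|y j / tau j| `^ s) (q / s)
    (fun=> powR_ge0 _ _) (fun=> powR_ge0 _ _).
  rewrite th0 th1 => /(_ isT); apply: le_trans.
  rewrite le_eqVlt; apply/orP; left; apply/eqP/eq_bigr => j _.
  rewrite -!powRrM divfK ?gt_eqF ?subr_gt0// mulrCA divff ?gt_eqF// mulr1.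
  by rewrite yE powRM.
rewrite conj_exp_pinfty// in P0 *.
case: q q0 qs P0 => [q| |]// q0 _ P0; last first.
  apply/psum_norm_pinfty_le => // j; rewrite yE ler_pM//.
    by apply: (psum_norm_pinfty_le _ _).1; rewrite ?psum_norm_ge0.
  by move: j; apply: (psum_norm_pinfty_le _ _).1; rewrite ?psum_norm_ge0.
rewrite lte_fin in q0.
rewrite psum_norm_fin_le// powRM ?psum_norm_ge0//.
apply: (@le_trans _ _
  (\sum_j `|tau j| `^ q * psum_norm +oo (fun j => y j / tau j) `^ q)).
  apply: ler_sum => j _; rewrite yE powRM// ler_wpM2l ?powR_ge0//.
  rewrite ge0_ler_powR ?nnegrE ?psum_norm_ge0 ?(ltW q0)//.
  by move: j; apply: (psum_norm_pinfty_le _ _).1; rewrite ?psum_norm_ge0.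
rewrite -mulr_suml ler_wpM2r ?powR_ge0//.
by rewrite -psum_norm_fin_le ?psum_norm_ge0.
Qed.

(** * Domination and its monotonicity in the exponent *)

(* For finite [p], by separation, [dominated p h N] means that [N j ^ p] is,
   for all [j] at once, at most a limit of averages of [h x j ^ p] over [x]. *)
Definition dominated (R : realType) (m : nat) (X : Type) (p : \bar R)
    (h : X -> 'I_m -> R) (N : 'I_m -> R) : Prop :=
  if p is p'%:E then
    forall (w : 'I_m -> R) (Y : R), (forall j, 0 <= w j) ->
      (forall x, \sum_j w j * h x j `^ p' <= Y) ->
      \sum_j w j * N j `^ p' <= Y
  else forall (j : 'I_m) (Y : R), 0 <= Y -> (forall x, h x j <= Y) -> N j <= Y.

(* [N] is fed back into the weights: [w N^(p' - p)] turns [sum w N^p'] into a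
   [p]-sum, and weighted AM-GM lets the resulting bound absorb a part of
   [sum w N^p'] itself. *)
Lemma dominated_mono (R : realType) (m : nat) (X : Type) (p p' : \bar R)
    (h : X -> 'I_m -> R) (N : 'I_m -> R) :
  (0 < p)%E -> (p <= p')%E ->
  (forall x j, 0 <= h x j) -> (forall j, 0 <= N j) ->
  dominated p h N -> dominated p' h N.
Proof.
move=> p0 pp' h0 N0.
case: p p0 pp' => [p| |]// p0; last by case: p'.
rewrite lte_fin in p0; case: p' => [p'| |]// pp' /= dom; last first.
  move=> j Y Y0 hY.
  (* For [p' = +oo] each coordinate is tested alone, by the indicator weight of [j]. *)
  have sumE (f : 'I_m -> R) : \sum_i (i == j)%:R * f i = f j.
    by rewrite (bigD1 j)//= eqxx mul1r big1 ?addr0// => i /negbTE->; rewrite mul0r.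
  have := dom (fun i => (i == j)%:R) (Y `^ p) (fun=> ler0n _ _).
  rewrite sumE => /(_ _)/wrap[x|NY].
    by rewrite sumE ge0_ler_powR ?nnegrE ?h0 ?(ltW p0).
  rewrite leNgt; apply/negP => YN.
  by have := gt0_ltr_powR p0 Y0 (N0 j) YN; rewrite ltNge NY.
rewrite lee_fin in pp'; have p'0 : 0 < p' by exact: lt_le_trans pp'.
move=> w Y w0 hY.
pose t := p / p'; set S := \sum_j w j * N j `^ p'.
have t0 : 0 < t by rewrite divr_gt0.
have t1 : t <= 1 by rewrite ler_pdivrMr// mul1r.
suff : S <= (1 - t) * S + t * Y.
  by move=> SY; rewrite -(ler_pM2l t0); lra.
have {1}-> : S = \sum_j (w j * N j `^ (p' - p)) * N j `^ p.
  apply: eq_bigr => j _; rewrite -mulrA -powRD ?subrK//.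
  by rewrite (gt_eqF p'0).
apply: dom => [j|x]; first by rewrite mulr_ge0 ?powR_ge0.
apply: (@le_trans _ _ (\sum_j ((1 - t) * (w j * N j `^ p') +
                               t * (w j * h x j `^ p')))).
  apply: ler_sum => j _.
  rewrite [X in _ <= X + _]mulrCA [X in _ <= _ + X]mulrCA -mulrA -mulrDr.
  rewrite ler_wpM2l//.
  have := @weighted_am_gm R (N j `^ p') (h x j `^ p') t
    (powR_ge0 _ _) (powR_ge0 _ _).
  rewrite -!powRrM mulrBr mulr1 /t mulrCA divff ?gt_eqF// mulr1; apply.
  by rewrite (ltW t0).
by rewrite big_split/= -!mulr_sumr lerD2l ler_wpM2l// ltW.
Qed.

Lemma dominated_in_range (R : realType) (m : nat) (X : Type) (p : \bar R)
    (h : X -> 'I_m -> R) (x : X) : dominated p h (h x).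
Proof. by case: p => [p| |] /= *; auto. Qed.

(** * The concave maximum over the polar hull *)

Lemma cvg_sumr (R : realType) (T : Type) (G : set_system T) (I : Type)
    (r : seq I) (f : I -> T -> R) (l : I -> R) :
  Filter G -> (forall i, f i @ G --> l i) ->
  \sum_(i <- r) f i x @[x --> G] --> \sum_(i <- r) l i.
Proof.
move=> FG fl; elim: r => [|i r IH].
  rewrite big_nil; under eq_fun do rewrite big_nil; exact: cvg_cst.
rewrite big_cons; under eq_fun do rewrite big_cons; exact: cvgD.
Qed.

Lemma cvg_powR (R : realType) (T : Type) (G : set_system T) (f : T -> R)
    (l t : R) :
  Filter G -> 0 < l -> f @ G --> l -> f x `^ t @[x --> G] --> l `^ t.
Proof.
move=> FG l0 fl.
apply: (@continuous_cvg T R R G FG f (fun a => a `^ t)) => //.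
apply: differentiable_continuous; apply/derivable1_diffP.
exact: (@ex_derive _ _ _ _ _ _ _ (is_derive1_powR t l0)).
Qed.

Section DualMaximum.
Context (R : realType) (m : nat) (X : Type) (v : X -> 'I_m -> R).

(** Only half-spaces with nonnegative normals are used, so membership in their intersection is
    literally the inequality that [dominated] asks of [p]-th powers. *)
Let halfspaces :=
  [set wY : ('I_m -> R) * R | (forall j, 0 <= wY.1 j) /\
    forall x, \sum_j wY.1 j * v x j <= wY.2].

Let hull : set 'rV[R]_m := [set z | forall wY, halfspaces wY ->
  \sum_j wY.1 j * z ord0 j <= wY.2].

Let closed_hull : closed hull.
Proof.
have -> : hull = \bigcap_(wY in halfspaces)
    ((fun z : 'rV[R]_m => \sum_j wY.1 j * z ord0 j) @^-1` [set y | y <= wY.2]).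
  by [].
apply: closed_bigI => wY _; apply: preimage_closed; last exact: closed_le.
move=> z _; apply: (@cvg_sumr R _ (nbhs z)) => j.
by apply: cvgMl_tmp; exact: coord_continuous.
Qed.

(* First-order condition for the maximum of the concave function
   [sum c (z + eps)^t] over the closed convex hull of [v]. *)
Lemma concave_dual_max (B t eps : R) (c : 'I_m -> R) (x0 : X) :
  (forall x j, 0 <= v x j <= B) -> (forall j, 0 <= c j) ->
  0 < t <= 1 -> 0 < eps ->
  exists z : 'I_m -> R, [/\ forall j, 0 <= z j,
    forall (w : 'I_m -> R) (Y : R), (forall j, 0 <= w j) ->
      (forall x, \sum_j w j * v x j <= Y) -> \sum_j w j * z j <= Y &
    forall x, \sum_j c j * (z j + eps) `^ (t - 1) * v x j <=
              \sum_j c j * (z j + eps) `^ (t - 1) * z j].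
Proof.
move=> vB c0 /andP[t0 t1] e0.
(* Nonnegative normals give no lower bound on the coordinates; the box supplies the compactness
   needed for a maximum to exist. *)
pose box := [set z : 'rV[R]_m | forall j, `[0, B]%classic (z ord0 j)].
pose Z := box `&` hull.
have cZ : compact Z.
  apply: compact_closedI => //; apply: (@rV_compact _ _ (fun=> `[0, B]%classic)).
  by move=> _; exact: segment_compact.
have Zv x : Z (\row_j v x j).
  split=> [j|wY [_ wv]]; first by rewrite /= mxE in_itv/= vB.
  by under eq_bigr do rewrite mxE.
have Zge z j : Z z -> 0 <= z ord0 j.
  by move=> [/(_ j) + _]; rewrite /= in_itv/= => /andP[].
pose f (z : 'rV[R]_m) := \sum_j c j * (z ord0 j + eps) `^ t.
have cf : {within Z, continuous f}.
  apply/subspace_continuousP => z zZ; apply: cvg_within_filter.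
  apply: (@cvg_sumr R _ (nbhs z)) => j; apply: cvgMl_tmp; apply: cvg_powR.
    by rewrite ltr_wpDl ?Zge.
  by apply: cvgD; [exact: coord_continuous|exact: cvg_cst].
have [|z /set_mem zZ zmax] := @EVT_max_rV R m f Z _ cZ cf.
  by exists (\row_j v x0 j).
exists (z ord0); split=> [j|w Y w0 wv|x]; first exact: Zge.
  by have [_ /(_ (w, Y))] := zZ; apply.
rewrite -subr_le0 -sumrB.
under eq_bigr do rewrite -mulrBr.
(* Up to the factor [t], [g d] is the derivative of [f] at [z + d (v x - z)] in the direction
   [v x - z]. It is shown to be nonpositive for small [d > 0]; the limit [d -> 0] is the claim. *)
pose g (d : R) := \sum_j c j *
  (z ord0 j + d * (v x j - z ord0 j) + eps) `^ (t - 1) * (v x j - z ord0 j).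
have g0 : g d @[d --> 0^'+] -->
    \sum_j c j * (z ord0 j + eps) `^ (t - 1) * (v x j - z ord0 j).
  apply: cvg_sumr => j; apply: cvgMr_tmp; apply: cvgMl_tmp; apply: cvg_powR.
    by rewrite ltr_wpDl ?Zge.
  apply: cvgD; last exact: cvg_cst.
  rewrite -[X in _ --> X]addr0 -[X in _ --> _ + X](mul0r (v x j - z ord0 j)).
  apply: cvgD; first exact: cvg_cst.
  by apply: cvgMr_tmp; apply: cvg_at_right_filter; exact: cvg_id.
apply: (cvgr_to_le g0); near=> d.
have d0 : 0 < d by near: d; exact: nbhs_right_gt.
have d1 : d <= 1 by near: d; exact: nbhs_right_le.
pose y : 'rV[R]_m := \row_j (z ord0 j + d * (v x j - z ord0 j)).
have yE j : y ord0 j = (1 - d) * z ord0 j + d * v x j by rewrite mxE; ring.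
have yZ : Z y.
  split=> [j|wY HwY].
    have := zZ.1 j; rewrite /= !in_itv/= yE => /andP[zj0 zjB].
    by have /andP[vj0 vjB] := vB x j; apply/andP; split; nra.
  have zw := zZ.2 _ HwY; have vw := HwY.2 x.
  under eq_bigr do rewrite yE mulrDr !(mulrCA (wY.1 _)).
  by rewrite big_split/= -!mulr_sumr; nra.
have fy : f y <= f z by apply: zmax; exact/mem_set.
(* The tangent is taken at the moved point [y] and evaluated at [z], where [z - y = - d (v x - z)].
   Together with [f y <= f z] this forces [g d <= 0]. *)
have tangent : f z + t * d * g d <= f y.
  rewrite /f /g mulr_sumr -big_split/=; apply: ler_sum => j _.
  have yj0 := Zge _ j yZ; have zj0 := Zge _ j zZ.
  have := @powR_le_tangent R (y ord0 j + eps) (z ord0 j + eps) t.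
  rewrite ltr_wpDl// addr_ge0 ?(ltW e0)// (ltW t0) t1 => /(_ isT isT isT).
  move=> /(ler_wpM2l (c0 j)) /le_trans h.
  rewrite -lerBrDr; apply: h; rewrite !mxE; rewrite le_eqVlt; apply/orP; left.
  by apply/eqP; ring.
have := le_trans tangent fy; rewrite gerDl pmulr_rle0// mulr_gt0//.
Unshelve. all: by end_near. Qed.

End DualMaximum.

(** * Domination expressed through norms and through positive weights *)

Lemma eq_psum_norm (R : realType) (m : nat) (p : \bar R) (x y : 'I_m -> R) :
  (forall j, `|x j| = `|y j|) -> psum_norm p x = psum_norm p y.
Proof.
by move=> xy; case: p => [p| |] /=; under eq_bigr do rewrite xy.
Qed.

Lemma psum_normZ (R : realType) (m : nat) (p : \bar R) (d : R) (x : 'I_m -> R) :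
  (0 < p)%E -> 0 <= d -> psum_norm p (fun j => d * x j) = d * psum_norm p x.
Proof.
move=> p0 d0; case: p p0 => [p| |]//= p0; last first.
  rewrite (big_morph ( *%R d) (fun y z => maxr_pMr y z d0) (mulr0 d))/=.
  by apply: eq_bigr => j _; rewrite normrM ger0_norm.
rewrite lte_fin in p0.
have -> : \sum_j `|d * x j| `^ p = d `^ p * \sum_j `|x j| `^ p.
  by rewrite mulr_sumr; apply: eq_bigr => j _; rewrite normrM powRM// ger0_norm.
rewrite powRM ?powR_ge0//; last by apply: sumr_ge0 => j _; exact: powR_ge0.
by rewrite -powRrM mulfV ?gt_eqF// powRr1.
Qed.

(** For finite [p] the weights [|w j| ^ p] turn the norm bound into the defining inequality; for
    [p = +oo] one divides by [|w j|] where it is nonzero. *)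
Lemma dominated_psum_norm (R : realType) (m : nat) (X : Type) (p : \bar R)
    (h : X -> 'I_m -> R) (N w : 'I_m -> R) (Y : R) :
  (0 < p)%E -> (forall x j, 0 <= h x j) -> (forall j, 0 <= N j) ->
  dominated p h N -> 0 <= Y ->
  (forall x, psum_norm p (fun j => w j * h x j) <= Y) ->
  psum_norm p (fun j => w j * N j) <= Y.
Proof.
case: p => [p| |]// p0 h0 N0 dom Y0 hY.
  rewrite lte_fin in p0; rewrite psum_norm_fin_le//.
  under eq_bigr => j _ do rewrite normrM powRM// (ger0_norm (N0 j)).
  apply: dom => [j|x]; first exact: powR_ge0.
  have := hY x; rewrite psum_norm_fin_le//.
  by under eq_bigr => j _ do rewrite normrM powRM// (ger0_norm (h0 x j)).
apply/psum_norm_pinfty_le => // j; rewrite normrM (ger0_norm (N0 j)).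
have [->|wj] := eqVneq (w j) 0; first by rewrite normr0 mul0r.
rewrite mulrC -ler_pdivlMr ?normr_gt0//; apply: dom => [|x].
  by rewrite divr_ge0.
rewrite ler_pdivlMr ?normr_gt0// mulrC -(ger0_norm (h0 x j)) -normrM.
by move: j {wj}; apply/psum_norm_pinfty_le.
Qed.

(** The mixing inequality allows only nonzero coefficients, hence gives information for positive
    weights only. Since [h] is bounded, raising every weight by a small [k] changes the bound
    arbitrarily little. *)
Lemma dominated_pos_weights (R : realType) (m : nat) (X : Type) (p B : R)
    (h : X -> 'I_m -> R) (N : 'I_m -> R) :
  0 < p -> (forall x j, 0 <= h x j <= B) ->
  (forall (w : 'I_m -> R) (Y : R), (forall j, 0 < w j) ->
    (forall x, \sum_j w j * h x j `^ p <= Y) -> \sum_j w j * N j `^ p <= Y) ->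
  dominated p%:E h N.
Proof.
move=> p0 hB pos w Y w0 hY; apply/ler_addgt0Pr => e e0.
pose C := \sum_(j < m) B `^ p.
have C0 : 0 <= C by apply: sumr_ge0 => j _; exact: powR_ge0.
have C1 : 0 < C + 1 by rewrite ltr_wpDl.
(* Chosen so that [k * C <= e]; the added 1 avoids a division by zero. *)
pose k := e / (C + 1); have k0 : 0 < k by rewrite divr_gt0.
apply: (@le_trans _ _ (\sum_j (w j + k) * N j `^ p)).
  by apply: ler_sum => j _; rewrite ler_wpM2r ?powR_ge0// lerDl ltW.
apply: pos => [j|x]; first by rewrite ltr_wpDl.
under eq_bigr do rewrite mulrDl; rewrite big_split/= -mulr_sumr lerD//.
apply: (@le_trans _ _ (k * C)).
  rewrite ler_pM2l//; apply: ler_sum => j _; have /andP[h0 hjB] := hB x j.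
  by rewrite ge0_ler_powR ?nnegrE ?(ltW p0) ?(le_trans h0).
by rewrite /k mulrAC ler_pdivrMr// ler_pM2l// lerDl.
Qed.

(** * Duality between splittings and dominated families *)

Section SplittingFunctional.
Context (R : realType) (m : nat) (X : Type).
Implicit Types (s q : \bar R) (sigma tau N : 'I_m -> R) (u : X -> 'I_m -> R).

(* [mixing_functional] is convertible to the case [u psi j = |M T _ _ _ psi|]. *)
Definition splitting_functional s q sigma u : \bar R :=
  ereal_inf [set ((psum_norm (conj_exp s q) tau)%:E *
      ereal_sup (range (fun x : X =>
        (psum_norm s (fun j => `|sigma j / tau j| * u x j))%:E)))%E
    | tau in [set tau : 'I_m -> R | forall j, tau j != 0]].

(** The easy half of the duality: for each [tau], Hoelder splits off [tau], and domination then
    replaces [N] by the supremum over [u]. *)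
Lemma dominated_le_splitting s q sigma u N (x0 : X) :
  (0 < q)%E -> (q <= s)%E ->
  (forall x j, 0 <= u x j) -> (forall j, 0 <= N j) -> dominated s u N ->
  ((psum_norm q (fun j => sigma j * N j))%:E <= splitting_functional s q sigma u)%E.
Proof.
move=> q0 qs u0 N0 dom; apply: le_ereal_inf_tmp => _ [tau t0 <-].
have s0 : (0 < s)%E by exact: lt_le_trans qs.
set S := ereal_sup _.
have leS x : ((psum_norm s (fun j => `|sigma j / tau j| * u x j))%:E <= S)%E.
  by apply: ereal_sup_ubound; exists x.
apply: (@le_trans _ _ ((psum_norm (conj_exp s q) tau)%:E *
    (psum_norm s (fun j => sigma j * N j / tau j))%:E)%E).
  by rewrite -EFinM lee_fin; exact: psum_norm_hoelder.
apply: lee_wpmul2l; first by rewrite lee_fin psum_norm_ge0.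
rewrite (@eq_psum_norm _ _ _ _ (fun j => `|sigma j / tau j| * N j)); last first.
  by move=> j; rewrite [in RHS]normrM normr_id -normrM mulrAC.
have S0 : (0 <= S)%E by apply: le_trans (leS x0); rewrite lee_fin psum_norm_ge0.
case: S leS S0 => [r| |]// leS S0; last by rewrite leey.
by rewrite lee_fin; apply: (@dominated_psum_norm _ _ _ _ u).
Qed.

Lemma splitting_le s q sigma u tau (Y : R) :
  (forall j, tau j != 0) ->
  (forall x, psum_norm s (fun j => `|sigma j / tau j| * u x j) <= Y) ->
  (splitting_functional s q sigma u <=
   (psum_norm (conj_exp s q) tau * Y)%:E)%E.
Proof.
move=> t0 uY; apply: ge_ereal_inf; eexists; first by exists tau.
rewrite EFinM; apply: lee_wpmul2l; first by rewrite lee_fin psum_norm_ge0.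
by apply: ge_ereal_sup => _ [x _ <-]; rewrite lee_fin.
Qed.

(** Here the exponent of [tau] is [+oo], and the constant family [tau = 1] suffices. *)
Lemma splitting_le_same q sigma u (D : R) : (0 < q)%E ->
  (forall x, psum_norm q (fun j => sigma j * u x j) <= D) -> 0 <= D ->
  (splitting_functional q q sigma u <= D%:E)%E.
Proof.
move=> q0 uD D0.
have cE : conj_exp q q = +oo%E.
  by case: q q0 {uD} => [q| |]// q0; rewrite ?conj_exp_same ?conj_exp_pinfty.
apply: (@le_trans _ _ (psum_norm (conj_exp q q) (fun=> 1 : R) * D)%:E).
  apply: splitting_le => [j|x]; first exact: oner_neq0.
  apply: le_trans (uD x); rewrite le_eqVlt; apply/orP; left; apply/eqP.
  by apply: eq_psum_norm => j; rewrite divr1 !normrM normr_id.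
rewrite lee_fin ler_piMl// cE; apply/psum_norm_pinfty_le => // j.
by rewrite normr1.
Qed.

(** The trial families [tau] below carry an error added to a [q]-th power; the choice
    [eta = (D + k) ^ q - D ^ q] turns it into an additive error [k]. *)
Lemma le_powR_invr_approx (e : \bar R) (q D : R) : 0 < q -> 0 <= D ->
  (forall eta, 0 < eta -> (e <= ((D `^ q + eta) `^ q^-1)%:E)%E) ->
  (e <= D%:E)%E.
Proof.
move=> q0 D0 he; apply/lee_addgt0Pr => k k0.
have := he ((D + k) `^ q - D `^ q).
rewrite subrKC -powRrM mulfV ?gt_eqF// powRr1 ?addr_ge0 ?(ltW k0)//.
rewrite EFinD; apply; rewrite subr_gt0.
by apply: gt0_ltr_powR; rewrite ?nnegrE ?addr_ge0 ?(ltW k0)// ltrDl.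
Qed.

(** For [s = +oo] the pointwise supremum of [u] is itself dominated. The exponent of [tau] is then
    [q], and [tau j = |sigma j * N j|] would be optimal if it never vanished. *)
Lemma splitting_le_pinfty (q : R) sigma u (D B : R) (x0 : X) : 0 < q ->
  (forall x j, 0 <= u x j <= B) ->
  (forall N, (forall j, 0 <= N j) -> dominated +oo%E u N ->
    psum_norm q%:E (fun j => sigma j * N j) <= D) -> 0 <= D ->
  (splitting_functional +oo q%:E sigma u <= D%:E)%E.
Proof.
move=> q0 uB ND D0; apply: (le_powR_invr_approx q0 D0) => eta eta0.
pose N j := sup (range (fun x => u x j)).
have uN x j : u x j <= N j.
  apply: ub_le_sup; last by exists x.
  by exists B => _ [y _ <-]; have /andP[] := uB y j.
have N0 j : 0 <= N j.
  by apply: le_trans (uN x0 j); have /andP[] := uB x0 j.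
have := ND N N0; rewrite psum_norm_fin_le// => /(_ _)/wrap[|NDq].
  by move=> j Y _ uY; apply: ge_sup => [|_ [x _ <-]]; first by exists (u x0 j), x0.
(* Adding [k] to each [q]-th power makes [tau] positive, at a total cost [m * k <= eta]. *)
pose k := eta / (m%:R + 1).
have m1 : 0 < m%:R + 1 :> R by rewrite ltr_wpDl.
have k0 : 0 < k by rewrite divr_gt0.
pose y j := `|sigma j * N j| `^ q + k.
have y0 j : 0 < y j by rewrite ltr_wpDl ?powR_ge0.
pose tau j := y j `^ q^-1.
have tau0 j : 0 < tau j by exact: powR_gt0.
apply: (@le_trans _ _ (psum_norm (conj_exp +oo q%:E) tau * 1)%:E).
  apply: splitting_le => [j|x]; first by rewrite gt_eqF.
  apply/psum_norm_pinfty_le => // j.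
  have /andP[u0 _] := uB x j.
  rewrite normrM normr_id normrM normfV (gtr0_norm (tau0 j)) mulrAC.
  rewrite ler_pdivrMr// mul1r.
  apply: (@le_trans _ _ ((`|sigma j * N j| `^ q) `^ q^-1)).
    rewrite -powRrM mulfV ?gt_eqF// powRr1// normrM ler_wpM2l//.
    by rewrite (ger0_norm u0) (ger0_norm (N0 j)).
  rewrite ge0_ler_powR ?nnegrE ?invr_ge0 ?powR_ge0 ?(ltW q0) ?(ltW (y0 j))//.
  by rewrite lerDl ltW.
rewrite mulr1 lee_fin conj_exp_pinfty// psum_norm_fin_le ?powR_ge0//.
rewrite -powRrM mulVf ?gt_eqF// powRr1 ?addr_ge0 ?powR_ge0 ?(ltW eta0)//.
under eq_bigr => j _ do
  rewrite (gtr0_norm (tau0 j)) -powRrM mulVf ?gt_eqF// powRr1 ?(ltW (y0 j))//.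
rewrite big_split/= lerD// sumr_const card_ord /k -mulrnAl -mulr_natr.
by rewrite ler_pdivrMr// ler_pM2l// lerDl.
Qed.

(** The maximizer [z] of the perturbed concave function gives both a dominated [N = z ^ (1/s)],
    which bounds the maximum [S] by [D ^ q + eta], and a family [tau] whose product of norms is at
    most [S ^ (1/q)]. *)
Lemma splitting_le_fin (s q : R) sigma u (D B : R) (x0 : X) :
  0 < q -> q < s -> (forall j, sigma j != 0) ->
  (forall x j, 0 <= u x j <= B) ->
  (forall N, (forall j, 0 <= N j) -> dominated s%:E u N ->
    psum_norm q%:E (fun j => sigma j * N j) <= D) -> 0 <= D ->
  (splitting_functional s%:E q%:E sigma u <= D%:E)%E.
Proof.
move=> q0 qs sg0 uB ND D0; apply: (le_powR_invr_approx q0 D0) => eta eta0.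
have s0 : 0 < s by exact: lt_trans qs.
pose t := q / s.
have t0 : 0 < t by rewrite divr_gt0.
have t1 : t < 1 by rewrite ltr_pdivrMr// mul1r.
have u0 x j : 0 <= u x j by have /andP[] := uB x j.
pose c j := `|sigma j| `^ q.
have c0 j : 0 <= c j by exact: powR_ge0.
pose C := \sum_j c j.
have C0 : 0 <= C by exact: sumr_ge0.
have C1 : 0 < C + 1 by rewrite ltr_wpDl.
(* By subadditivity of the power [t], the perturbation raises the sum by at most
   [C * eps ^ t = C * k <= eta]. *)
pose k := eta / (C + 1); have k0 : 0 < k by rewrite divr_gt0.
pose eps := k `^ t^-1; have eps0 : 0 < eps by exact: powR_gt0.
have epst : eps `^ t = k by rewrite -powRrM mulVf ?gt_eqF// powRr1// ltW.
have [|||//|z [z0 zdom zmax]] := @concave_dual_max R m X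
    (fun x j => u x j `^ s) (B `^ s) t eps c x0.
- move=> x j; have /andP[uj0 ujB] := uB x j.
  by rewrite powR_ge0/= ge0_ler_powR ?nnegrE ?(ltW s0) ?(le_trans uj0).
- exact: c0.
- by rewrite t0 ltW.
pose S := \sum_j c j * (z j + eps) `^ t.
have ze0 j : 0 < z j + eps by rewrite ltr_wpDl.
have S0 : 0 <= S by apply: sumr_ge0 => j _; rewrite mulr_ge0 ?powR_ge0.
have SD : S <= D `^ q + eta.
  apply: (@le_trans _ _ (\sum_j (c j * z j `^ t + c j * k))).
    apply: ler_sum => j _; rewrite -mulrDr ler_wpM2l// -epst.
    by apply: powRD_le; rewrite ?(ltW eps0)// (ltW t0) ltW.
  rewrite big_split/= lerD//; last first.
    by rewrite -mulr_suml /k mulrCA ler_piMr ?(ltW eta0)// ler_pdivrMr// mul1r lerDl.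
  have := ND (fun j => z j `^ s^-1) (fun=> powR_ge0 _ _).
  rewrite psum_norm_fin_le// => /(_ _)/wrap[|NDq].
    move=> w Y w0 wY; apply: le_trans (zdom w Y w0 wY).
    apply: ler_sum => j _.
    by rewrite -powRrM mulVf ?gt_eqF// powRr1.
  apply: le_trans _ NDq; rewrite le_eqVlt; apply/orP; left; apply/eqP.
  apply: eq_bigr => j _; rewrite normrM powRM// (ger0_norm (powR_ge0 _ _)).
  by rewrite -powRrM (mulrC _ q).
(* The exponent [(1 - t) / s] of [tau] makes [|tau j| ^ r = c j * (z j + eps) ^ t], with sum [S],
   and [|sigma j / tau j| ^ s = c j * (z j + eps) ^ (t - 1)], the weights of the first-order
   condition [zmax]. *)
pose y j := `|sigma j| `^ s * (z j + eps).
have y0 j : 0 < y j by rewrite mulr_gt0 ?powR_gt0 ?normr_gt0.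
pose tau j := y j `^ ((1 - t) / s).
have tau0 j : 0 < tau j by exact: powR_gt0.
apply: (@le_trans _ _ (psum_norm (conj_exp s%:E q%:E) tau * S `^ s^-1)%:E).
  apply: splitting_le => [j|x]; first by rewrite gt_eqF.
  rewrite psum_norm_fin_le ?powR_ge0// -powRrM mulVf ?gt_eqF// powRr1//.
  apply: (@le_trans _ _ (\sum_j c j * (z j + eps) `^ (t - 1) * u x j `^ s)).
    apply: ler_sum => j _; rewrite le_eqVlt; apply/orP; left; apply/eqP.
    rewrite normrM normr_id powRM// (ger0_norm (u0 x j)); congr (_ * _).
    rewrite normrM powRM// normfV (gtr0_norm (tau0 j)) -powR_inv1 ?(ltW (tau0 j))//.
    rewrite -!powRrM /y powRM ?powR_ge0 ?(ltW (ze0 j))// -powRrM mulrA -powRD.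
      congr (_ `^ _ * _ `^ _); rewrite /t; field; rewrite ?gt_eqF//.
    by rewrite normr_eq0 sg0 implybT.
  apply: le_trans (zmax x) _; apply: ler_sum => j _.
  rewrite -mulrA ler_wpM2l//.
  have -> : (z j + eps) `^ t = (z j + eps) `^ (t - 1) * (z j + eps).
    rewrite -{3}(powRr1 (ltW (ze0 j))) -powRD ?subrK//.
    by rewrite (gt_eqF (ze0 j)) implybT.
  by rewrite ler_wpM2l ?powR_ge0// lerDl ltW.
rewrite lee_fin conj_exp_fin//=.
have -> : \sum_j `|tau j| `^ (q / (1 - q / s)) = S.
  apply: eq_bigr => j _; rewrite (gtr0_norm (tau0 j)) -powRrM -/t.
  have -> : (1 - t) / s * (q / (1 - t)) = t.
    by rewrite /t; field; rewrite !gt_eqF// subr_gt0.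
  rewrite /y powRM ?powR_ge0 ?(ltW (ze0 j))// -powRrM /t mulrCA mulfV ?gt_eqF//.
  by rewrite mulr1.
(* The powers [1/r] and [1/s] of [S] combine to [S ^ (1/q)]. *)
rewrite -/t -powRD.
  have -> : (q / (1 - t))^-1 + s^-1 = q^-1.
    by rewrite /t; field; rewrite !gt_eqF// subr_gt0.
  by rewrite ge0_ler_powR ?nnegrE ?invr_ge0 ?(ltW q0)// addr_ge0 ?powR_ge0 ?ltW.
rewrite gt_eqF// addr_gt0 ?invr_gt0// divr_gt0// subr_gt0//.
Qed.

(** The hard half of the duality, assembled from the cases [s = q], [s] finite and [s = +oo]. *)
Lemma splitting_le_dominated s q sigma u (D B : R) (x0 : X) :
  (0 < q)%E -> (q <= s)%E -> (forall j, sigma j != 0) ->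
  (forall x j, 0 <= u x j <= B) ->
  (forall N, (forall j, 0 <= N j) -> dominated s u N ->
    psum_norm q (fun j => sigma j * N j) <= D) -> 0 <= D ->
  (splitting_functional s q sigma u <= D%:E)%E.
Proof.
move=> q0; rewrite le_eqVlt => /predU1P[<- sg0 uB ND D0|qs sg0 uB ND D0].
  apply: splitting_le_same => // x; apply: ND; last exact: dominated_in_range.
  by move=> j; have /andP[] := uB x j.
case: q q0 qs ND => [q| |]// q0 qs ND; last by rewrite ltNge leey in qs.
case: s qs ND => [s| |]// qs ND.
  by apply: (@splitting_le_fin s q sigma u D B x0).
by apply: (@splitting_le_pinfty q sigma u D B x0).
Qed.

End SplittingFunctional.

(** * Uniform bounds by compactness and the inclusion of the mixing classes *)

Lemma compact_uniform_bound (R : realType) (X : topologicalType) (m : nat)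
    (f : 'I_m -> X -> R) (x0 : X) :
  compact [set: X] -> (forall j, continuous (f j)) ->
  exists B, forall x j, `|f j x| <= B.
Proof.
move=> cX cf.
have /choice[c cP] j : exists c, forall x, `|f j x| <= `|f j c|.
  have [|x|c _ cmax] := @compact_EVT_max X R (fun x => `|f j x|) setT _ cX.
  - by exists x0.
  - by apply: continuous_subspaceT => {}x; apply: cvg_norm; exact: cf.
  - by exists c => x; apply: cmax; rewrite inE.
exists (\sum_j `|f j (c j)|) => x j.
by apply: le_trans (cP j x) _; rewrite (bigD1 j)//= lerDl sumr_ge0.
Qed.

Theorem proposition14 (R : realType) (A B C : Type)
    (G : completeNormedModType R) (K W : topologicalType)
    (F : set (A -> B))
    (H : A -> C -> G -> K -> R) (M : F -> A -> C -> G -> W -> R)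
    (A_nonvoid : [set: A] !=set0) (B_nonvoid : [set: B] !=set0)
    (C_nonvoid : [set: C] !=set0) (F_nonvoid : F !=set0)
    (K_nonvoid : [set: K] !=set0) (K_compact : compact [set: K])
    (K_hausdorff : hausdorff_space K)
    (W_nonvoid : [set: W] !=set0) (W_compact : compact [set: W])
    (W_hausdorff : hausdorff_space W)
    (H_continuous : forall (a : A) (c : C) (g : G),
       continuous (fun phi : K => H a c g phi))
    (M_continuous : forall (T : F) (a : A) (c : C) (g : G),
       continuous (fun psi : W => M T a c g psi))
    (q1 q2 s2 s1 : \bar R)
    (q1_gt0 : (0 < q1)%E) (le_q1_q2 : (q1 <= q2)%E)
    (le_q2_s2 : (q2 <= s2)%E) (le_s2_s1 : (s2 <= s1)%E) :
  mixing_class H M s1 q1 `<=` mixing_class H M s2 q2.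
Proof.
move=> T; rewrite /mixing_class /= => mixT.
(* If [q1 = +oo], all four exponents are [+oo] and hypothesis and conclusion coincide. *)
case: q1 q1_gt0 le_q1_q2 mixT => [q| |]// q_gt0 qq2 mixT; last first.
  move: qq2 le_q2_s2 le_s2_s1; rewrite leye_eq => /eqP->.
  by rewrite leye_eq => /eqP->; rewrite leye_eq => /eqP s1y; rewrite s1y in mixT.
have [delta d0 mix] := mixT.
have [phi0 _] := K_nonvoid; have [psi0 _] := W_nonvoid.
have q2_gt0 : (0 < q2)%E by exact: lt_le_trans qq2.
have s2_gt0 : (0 < s2)%E by exact: lt_le_trans le_q2_s2.
have q_le_s1 : (q%:E <= s1)%E.
  exact: le_trans qq2 (le_trans le_q2_s2 le_s2_s1).
exists delta => // m sigma a c g sigma0.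
(* The constant [delta] is absorbed into [h], so that mixing becomes a comparison of domination by
   [u] with domination by [h]. *)
pose u psi j := `|M T (a j) (c j) (g j) psi|.
pose h phi j := delta * `|H (a j) (c j) (g j) phi|.
have u0 psi j : 0 <= u psi j by exact: normr_ge0.
have h0 phi j : 0 <= h phi j by rewrite mulr_ge0.
have [Bu uB] := @compact_uniform_bound R W m.+1
  (fun j => M T (a j) (c j) (g j)) psi0 W_compact (fun j => @M_continuous T _ _ _).
have [Bh hB] := @compact_uniform_bound R K m.+1
  (fun j => H (a j) (c j) (g j)) phi0 K_compact (fun j => @H_continuous _ _ _).
have weakE p tau : (0 < p)%E -> (delta%:E * weak_norm H p tau a c g)%E =
    ereal_sup (range (fun phi => (psum_norm p (fun j => tau j * h phi j))%:E)).
  move=> p0; rewrite /weak_norm -ereal_supZl//; last first.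
    by apply/set0P; eexists; exists phi0.
  congr ereal_sup; rewrite image_comp; apply: eq_imagel => phi _ /=.
  rewrite -EFinM -psum_normZ//; congr (_%:E); apply: eq_psum_norm => j.
  by rewrite /h mulrCA [LHS]normrM [RHS]normrM !normrM !normr_id.
have domN N : (forall j, 0 <= N j) -> dominated s2 u N -> dominated q2 h N.
  move=> N0 /(dominated_mono s2_gt0 le_s2_s1 u0 N0) domu.
  apply: (dominated_mono _ qq2) => //.
  apply: (@dominated_pos_weights _ _ _ _ (delta * Bh)) => //.
    by move=> phi j; rewrite h0/= ler_wpM2l.
  move=> w Y w0 hY.
  have Y0 : 0 <= Y.
    apply: le_trans (hY phi0); apply: sumr_ge0 => j _.
    by rewrite mulr_ge0 ?powR_ge0// ltW.
  (* Positive weights [w] correspond to the nonzero coefficients [w ^ (1/q)], to which the mixing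
     hypothesis applies. *)
  have wE (f : 'I_m.+1 -> R) : (forall j, 0 <= f j) ->
      (psum_norm q%:E (fun j => w j `^ q^-1 * f j) <= Y `^ q^-1) =
      (\sum_j w j * f j `^ q <= Y).
    move=> f0; rewrite psum_norm_fin_le ?powR_ge0// -powRrM mulVf ?gt_eqF//.
    rewrite powRr1//; congr (_ <= _); apply: eq_bigr => j _.
    rewrite normrM powRM// !ger0_norm ?powR_ge0// -powRrM mulVf ?gt_eqF//.
    by rewrite powRr1// ltW.
  rewrite -wE// -lee_fin.
  apply: le_trans (dominated_le_splitting _ psi0 q_gt0 q_le_s1 u0 N0 domu) _.
  apply: le_trans (mix m (fun j => w j `^ q^-1) a c g _) _.
    by move=> j; rewrite gt_eqF// powR_gt0.
  rewrite weakE//; apply: ge_ereal_sup => _ [phi _ <-].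
  by rewrite lee_fin wE.
rewrite weakE//; set S := ereal_sup _.
have leS phi : ((psum_norm q2 (fun j => sigma j * h phi j))%:E <= S)%E.
  by apply: ereal_sup_ubound; exists phi.
have S0 : (0 <= S)%E by apply: le_trans (leS phi0); rewrite lee_fin psum_norm_ge0.
(* An infinite weak norm leaves nothing to prove; a finite one is the bound [D] fed to the hard half
   of the duality. *)
case: S leS S0 => [D| |]// leS D0; last by rewrite leey.
apply: (@splitting_le_dominated R m.+1 W s2 q2 sigma u D Bu psi0) => // [psi j|N N0 domu].
  by rewrite u0 uB.
exact: (dominated_psum_norm _ h0 N0 (domN N N0 domu)).
Qed.
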